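(* Let $1\le d\le n$ be integers, let $v\in S_d$ be a pattern, and let $\mu$ be any log-supermodular probability measure on $\mathcal{P}(n)$. For a family $\mathcal{B}\subseteq\mathcal{P}(n)$ define $$\nu_{\mathcal{B}}:=\mu\left(\{A\in\mathcal{P}(n): B\not\subseteq A \text{ for all } B\in\mathcal{B}\}\right).$$ Then $$\prod_{r=1}^{\binom{n}{d}}\ \prod_{\{B_1,\dots,B_r\}} \nu_{\{B_1,\dots,B_r\}}^{\,f^v_{\{B_1,\dots,B_r\}}(S_n)}\ \leq \sum_{A\subseteq[n],\,|A|<d}\mu(A),$$ where the inner product ranges over all families $\{B_1,\dots,B_r\}$ of $r$ distinct sets in $[n]_d$ (with the convention $0^0=1$).
   Context: $\mathcal{P}(n)$ is the set of all subsets of $[n]=\{1,\dots,n\}$, a distributive lattice under inclusion (meet $\cap$, join $\cup$). A function $\mu:\mathcal{P}(n)\to\mathbb{R}_{\ge0}$ is log-supermodular if $\mu(A)\mu(B)\le\mu(A\cap B)\mu(A\cup B)$ for all $A,B$. $[n]_d$ denotes the set of $d$-element subsets of $[n]$. $S_n$ is the set of permutations of $[n]$. A sequence of $d$ distinct numbers is order-isomorphic to $v\in S_d$ if its entries are in the same relative order as $v_1,\dots,v_d$. For $\pi\in S_n$, $\mathcal{B}_\pi(v)\subseteq[n]_d$ is the set of $B=\{j_1<\dots<j_d\}$ such that $\pi_{j_1}\cdots\pi_{j_d}$ is order-isomorphic to $v$. For distinct $B_1,\dots,B_r\in[n]_d$, $f^v_{\{B_1,\dots,B_r\}}(S_n)$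 is the number of $\pi\in S_n$ with $\mathcal{B}_\pi(v)=\{B_1,\dots,B_r\}$. *)

(* Defs.v *)
From HB Require Import structures.
From mathcomp Require Import all_boot all_order all_fingroup all_algebra.
From mathcomp Require Import reals.
Set Implicit Arguments. Unset Strict Implicit. Unset Printing Implicit Defensive.
Import Order.TTheory GRing.Theory Num.Theory.
Local Open Scope ring_scope.

(* [n] is represented by 'I_n = {0, ..., n-1} throughout, and P(n) by
   {set 'I_n}; only the order of the labels matters below. *)

Section Measures.
Variables (R : realType) (n : nat).
Implicit Types (mu : {set 'I_n} -> R) (BB : {set {set 'I_n}}).

Definition measure_of mu (F : {set {set 'I_n}}) : R := \sum_(A in F) mu A.

Definition probability_measure mu : Prop :=
  (forall A, 0 <= mu A) /\ measure_of mu [set: {set 'I_n}] = 1.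

Definition log_supermodular mu : Prop :=
  forall A B, mu A * mu B <= mu (A :&: B) * mu (A :|: B).

Definition nu mu BB : R :=
  measure_of mu [set A : {set 'I_n} | [forall B in BB, ~~ (B \subset A)]].

End Measures.

Definition dsubsets (n d : nat) : {set {set 'I_n}} :=
  [set B : {set 'I_n} | #|B| == d].

Definition order_isomorphic (s t : seq nat) : bool :=
  (size s == size t) &&
  [forall i : 'I_(size s), forall j : 'I_(size s),
     (nth 0%N s i < nth 0%N s j)%N == (nth 0%N t i < nth 0%N t j)%N].

Definition one_line (d : nat) (v : 'S_d) : seq nat :=
  [seq (v i : nat) | i <- enum 'I_d].

(* The word pi_{j_1} ... pi_{j_d} for B = {j_1 < ... < j_d}; that enum lists B
   in increasing order is enum_set_sorted. *)
Definition subword (n : nat) (p : 'S_n) (B : {set 'I_n}) : seq nat :=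
  [seq (p j : nat) | j <- enum B].

Lemma enum_set_sorted (n : nat) (B : {set 'I_n}) :
  sorted ltn [seq val j | j <- enum B].
Proof.
rewrite {1}/enum_mem -enumT sorted_map.
apply: sorted_filter; first by move=> x y z; apply: ltn_trans.
by rewrite -sorted_map val_enum_ord iota_ltn_sorted.
Qed.

Definition occurrences (n d : nat) (v : 'S_d) (p : 'S_n) : {set {set 'I_n}} :=
  [set B in dsubsets n d | order_isomorphic (subword p B) (one_line v)].

(* f^v_{BB}(S_n). *)
Definition occurrence_count (n d : nat) (v : 'S_d) (BB : {set {set 'I_n}}) : nat :=
  #|[set p : 'S_n | occurrences v p == BB]|.

(* Main.v *)
Require Import Defs.
From HB Require Import structures.
From mathcomp Require Import all_boot all_order all_fingroup all_algebra.
From mathcomp Require Import reals.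
From mathcomp Require Import lra.
Set Implicit Arguments. Unset Strict Implicit. Unset Printing Implicit Defensive.
Import Order.TTheory GRing.Theory Num.Theory.
Local Open Scope ring_scope.

(** For a family BB of sets, the sets containing no member of BB form a
    down-set, and the down-set of a union of families is the intersection of
    the down-sets.  The FKG inequality, obtained here from the four functions
    theorem of Ahlswede and Daykin, therefore gives
    [nu BB * nu BB' <= nu (BB :|: BB')].  The left-hand side of the theorem is
    the product of [nu (occurrences v p)] over all permutations [p], since the
    factor of the empty family is 1.  Every d-subset is an occurrence of v in
    some permutation, so the union of all these families is [dsubsets n d], and
    a set contains no d-subset exactly when it has fewer than d elements. *)

(** * The four functions theorem *)

(** This is the case of a one-element ground set. Put [u = c0 * e1], [w = c1 * e0], [p = a0 * b1],
    [q = a1 * b0]. Then [p] and [q] are at most [u], and [p * q <= u * w], so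
    [0 <= (u - p) * (u - q)] gives [u * (p + q) <= u * (u + w)]. If [u = 0], then [p] and [q] are at
    most 0. *)
Lemma four_numbers (R : realFieldType) (a0 a1 b0 b1 c0 c1 e0 e1 : R) :
  0 <= a0 -> 0 <= a1 -> 0 <= b0 -> 0 <= b1 ->
  0 <= c0 -> 0 <= c1 -> 0 <= e0 -> 0 <= e1 ->
  a0 * b0 <= c0 * e0 -> a0 * b1 <= c0 * e1 ->
  a1 * b0 <= c0 * e1 -> a1 * b1 <= c1 * e1 ->
  (a0 + a1) * (b0 + b1) <= (c0 + c1) * (e0 + e1).
Proof.
move=> a0p a1p b0p b1p c0p c1p e0p e1p h00 h01 h10 h11.
have c1e0 : 0 <= c1 * e0 by apply: mulr_ge0.
have : a0 * b1 + a1 * b0 <= c0 * e1 + c1 * e0; last by lra.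
have [u0|u_neq0] := eqVneq (c0 * e1) 0; first by lra.
have u_gt0 : 0 < c0 * e1 by rewrite lt_def u_neq0 mulr_ge0.
have pq : (a0 * b1) * (a1 * b0) <= (c0 * e1) * (c1 * e0).
  have := ler_pM (mulr_ge0 a0p b0p) (mulr_ge0 a1p b1p) h00 h11.
  by lra.
rewrite -(ler_pM2l u_gt0).
have : 0 <= (c0 * e1 - a0 * b1) * (c0 * e1 - a1 * b0).
  by rewrite mulr_ge0 // subr_ge0.
by lra.
Qed.

Lemma sum_subsetsU1 (R : nmodType) (T : finType) (x : T) (S : {set T})
    (f : {set T} -> R) :
  x \notin S ->
  \sum_(A : {set T} | A \subset x |: S) f A =
  \sum_(A : {set T} | A \subset S) (f A + f (x |: A)).
Proof.
move=> xS; rewrite (bigID (fun A : {set T} => x \in A)) /= addrC big_split /=.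
congr (_ + _).
  apply: eq_bigl => A; apply/andP/idP => [[/subsetP sA xA]|sA].
    apply/subsetP => y yA; have := sA y yA; rewrite !inE => /orP[/eqP yx|//].
    by rewrite yx (negPf xA) in yA *.
  split; first exact: subset_trans sA (subsetUr _ _).
  by apply: contra xS; apply: (subsetP sA).
rewrite (reindex_onto (fun A => x |: A) (fun A => A :\ x)) /=; last first.
  by move=> A /andP[_ xA]; rewrite setD1K.
apply: eq_bigl => A; rewrite setU11 andbT.
apply/andP/idP => [[sA /eqP eA]|sA].
  have xA : x \notin A by rewrite -eA !inE eqxx.
  apply/subsetP => y yA; have /subsetP/(_ y) := sA.
  rewrite !inE yA orbT => /(_ isT) /orP[/eqP yx|//].
  by rewrite yx (negPf xA) in yA *.
split; first exact: setUS.
by rewrite setU1K //; apply: contra xS; apply: (subsetP sA).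
Qed.

(** Induction on [#|S|]: for [x] in [S], each function [f] is replaced by [f A + f (x |: A)] on the
    subsets of [S :\ x], and [four_numbers] carries the hypothesis over. Restricting the hypothesis
    to subsets of [S] ensures that neither set contains [x] in this step. *)
Lemma four_functions_subsets (R : realFieldType) (T : finType) (S : {set T})
    (a b c e : {set T} -> R) :
  (forall A, 0 <= a A) -> (forall A, 0 <= b A) ->
  (forall A, 0 <= c A) -> (forall A, 0 <= e A) ->
  {in [pred A : {set T} | A \subset S] &, forall A B,
     a A * b B <= c (A :&: B) * e (A :|: B)} ->
  (\sum_(A : {set T} | A \subset S) a A) *
  (\sum_(A : {set T} | A \subset S) b A) <=
  (\sum_(A : {set T} | A \subset S) c A) *
  (\sum_(A : {set T} | A \subset S) e A).
Proof.
have [m] := ubnP #|S|; elim: m => // m IH in S a b c e *.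
move=> Sm ap bp cp ep h.
have [->|[x xS]] := set_0Vmem S.
  have sub0 (f : {set T} -> R) :
      \sum_(A : {set T} | A \subset set0) f A = f set0.
    by rewrite (eq_bigl (pred1 set0)) ?big_pred1_eq // => A; rewrite subset0.
  rewrite !sub0; have := h set0 set0; rewrite setI0 setU0.
  by apply; apply: sub0set.
have xS' : x \notin S :\ x by rewrite !inE eqxx.
rewrite -(setD1K xS) !sum_subsetsU1 //.
apply: IH => [|A|A|A|A|A B]; rewrite ?addr_ge0 //.
  by rewrite (cardsD1 x) xS in Sm.
rewrite !inE => sA sB.
have xA : x \notin A by apply: contra xS'; apply: (subsetP sA).
have xB : x \notin B by apply: contra xS'; apply: (subsetP sB).
have sA' : A \subset S by apply: subset_trans sA (subsetDl _ _).
have sB' : B \subset S by apply: subset_trans sB (subsetDl _ _).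
have sxA : x |: A \subset S by rewrite subUset sub1set xS.
have sxB : x |: B \subset S by rewrite subUset sub1set xS.
have Ix0 (C : {set T}) : x \notin C -> [set x] :&: C = set0.
  by move=> xC; apply/setP => y; rewrite !inE; case: eqP => // ->; apply/negbTE.
(* The index 1 marks sets containing [x]: the intersection has it when both sets do, the union when
   at least one does. *)
apply: four_numbers => //.
- exact: h.
- have := h A (x |: B) sA' sxB.
  by rewrite setIUr setUCA (setIC A [set x]) Ix0 // set0U.
- have := h (x |: A) B sxA sB'.
  by rewrite setIUl -setUA Ix0 // set0U.
- have := h (x |: A) (x |: B) sxA sxB.
  by rewrite -setUIr -setUUr.
Qed.

Lemma four_functions (R : realFieldType) (T : finType)
    (a b c e : {set T} -> R) :
  (forall A, 0 <= a A) -> (forall A, 0 <= b A) ->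
  (forall A, 0 <= c A) -> (forall A, 0 <= e A) ->
  (forall A B, a A * b B <= c (A :&: B) * e (A :|: B)) ->
  (\sum_A a A) *
  (\sum_A b A) <= (\sum_A c A) * (\sum_A e A).
Proof.
move=> ap bp cp ep h.
have := four_functions_subsets (S := [set: T]) ap bp cp ep (in2W h).
by rewrite !(eq_bigl predT) // => A; rewrite subsetT.
Qed.

(** * The FKG inequality and products of [nu] *)

Section LogSupermodular.
Variables (R : realType) (n : nat) (mu : {set 'I_n} -> R).
Hypotheses (hprob : probability_measure mu) (hlsm : log_supermodular mu).

Definition down_closed (F : {set {set 'I_n}}) : Prop :=
  forall A B : {set 'I_n}, A \subset B -> B \in F -> A \in F.

(** Four functions theorem for [mu] cut off to [F], to [G] and to [F :&: G], with [mu] itself as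
    fourth function, whose total mass is 1. If [A] is in [F] and [B] in [G], then [A :&: B] lies in
    both down-sets. *)
Lemma FKG_down_closed (F G : {set {set 'I_n}}) :
  down_closed F -> down_closed G ->
  measure_of mu F * measure_of mu G <= measure_of mu (F :&: G).
Proof.
move=> dF dG; have [mu_ge0 mu1] := hprob.
have muT : \sum_A mu A = 1.
  by rewrite -mu1; apply: eq_bigl => A; rewrite inE.
rewrite /measure_of big_mkcond [X in _ * X]big_mkcond [leRHS]big_mkcond /=.
rewrite -[leRHS]mulr1 -muT; apply: four_functions => [A|A|A|//|A B].
1-3: by case: ifP.
case: ifPn => [AF|_]; last by rewrite mul0r mulr_ge0 //; case: ifP.
case: ifPn => [BG|_]; last by rewrite mulr0 mulr_ge0 //; case: ifP.
rewrite in_setI (dF _ _ (subsetIl _ _) AF) (dG _ _ (subsetIr _ _) BG).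
exact: hlsm.
Qed.

Lemma nu_ge0 (BB : {set {set 'I_n}}) : 0 <= nu mu BB.
Proof. by apply: sumr_ge0 => A _; case: hprob. Qed.

Lemma nu_set0 : nu mu set0 = 1.
Proof.
have [_ <-] := hprob; apply: eq_bigl => A; rewrite !inE.
by apply/forall_inP => B; rewrite inE.
Qed.

Lemma nuU (BB CC : {set {set 'I_n}}) :
  nu mu BB * nu mu CC <= nu mu (BB :|: CC).
Proof.
have dc (DD : {set {set 'I_n}}) :
    down_closed [set A : {set 'I_n} | [forall B in DD, ~~ (B \subset A)]].
  move=> A B sAB; rewrite !inE => /forall_inP h; apply/forall_inP => C CD.
  by apply: contra (h C CD) => sCA; apply: subset_trans sCA sAB.
rewrite (le_trans (FKG_down_closed (dc BB) (dc CC))) // le_eqVlt.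
apply/orP; left; apply/eqP; apply: eq_bigl => A; rewrite !inE.
apply/andP/forall_inP => [[/forall_inP hB /forall_inP hC] D|h].
  by rewrite inE => /orP[/hB|/hC].
by split; apply/forall_inP => D DD; apply: h; rewrite inE DD ?orbT.
Qed.

Lemma prod_nu_le (I : Type) (r : seq I) (BB : I -> {set {set 'I_n}}) :
  \prod_(i <- r) nu mu (BB i) <= nu mu (\bigcup_(i <- r) BB i).
Proof.
elim: r => [|i r IH]; first by rewrite !big_nil nu_set0.
rewrite !big_cons; apply: le_trans (nuU _ _).
by rewrite ler_wpM2l // nu_ge0.
Qed.

End LogSupermodular.

(** * Subsets of size [d] and occurrences of the pattern *)

Lemma nu_dsubsets (R : realType) (n d : nat) (mu : {set 'I_n} -> R) :
  nu mu (dsubsets n d) = \sum_(A : {set 'I_n} | (#|A| < d)%N) mu A.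
Proof.
apply: eq_bigl => A; rewrite inE; apply/forall_inP/idP => [h|cA B].
  rewrite ltnNge; apply/negP => dA.
  (* The number of such [B] is ['C(#|A|, d)], which is positive since [d <= #|A|]. *)
  have /set0Pn[B] : [set B : {set 'I_n} | B \subset A & #|B| == d] != set0.
    by rewrite -card_gt0 cards_draws bin_gt0.
  rewrite inE => /andP[sBA cB]; have := h B; rewrite inE cB sBA.
  by move=> /(_ isT).
rewrite inE => /eqP cB; apply/negP => /subset_leq_card.
by rewrite cB leqNgt cA.
Qed.

Lemma order_isomorphic_refl (s : seq nat) : order_isomorphic s s.
Proof. by rewrite /order_isomorphic eqxx; apply/'forall_forallP => i j /=. Qed.

Lemma size_one_line (d : nat) (v : 'S_d) : size (one_line v) = d.
Proof. by rewrite size_map size_enum_ord. Qed.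

Lemma one_line_lt (d : nat) (v : 'S_d) (i : nat) :
  (i < d)%N -> (nth 0%N (one_line v) i < d)%N.
Proof.
move=> id; have /mapP[j _ ->] : nth 0%N (one_line v) i \in one_line v.
  by rewrite mem_nth // size_one_line.
exact: ltn_ord.
Qed.

Lemma uniq_one_line (d : nat) (v : 'S_d) : uniq (one_line v).
Proof.
by rewrite map_inj_uniq ?enum_uniq // => i j /val_inj /perm_inj.
Qed.

(* The permutation spells v along B and fills the other positions with the
   values d, d + 1, ... in increasing order. *)
Lemma dsubset_occurrence (n d : nat) (v : 'S_d) (B : {set 'I_n}) :
  #|B| = d -> exists p : 'S_n, B \in occurrences v p.
Proof.
move=> cB.
pose f (j : 'I_n) : nat :=
  if j \in B then nth 0%N (one_line v) (index j (enum B))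
  else (d + index j (enum (~: B)))%N.
have idxB j : j \in B -> (index j (enum B) < d)%N.
  by move=> jB; rewrite -cB cardE index_mem mem_enum.
have idxC j : j \notin B -> (index j (enum (~: B)) < #|~: B|)%N.
  by move=> jB; rewrite cardE index_mem mem_enum inE.
have dn : (d + #|~: B| = n)%N by rewrite -cB cardsC card_ord.
have f_lt j : (f j < n)%N.
  rewrite /f; case: ifPn => jB; last by rewrite -[ltnRHS]dn ltn_add2l idxC.
  by rewrite (leq_trans (one_line_lt v (idxB j jB))) // -[leqRHS]dn leq_addr.
have f_inj : injective f.
  have index_eq (C : {set 'I_n}) i j :
      i \in C -> j \in C -> index i (enum C) = index j (enum C) -> i = j.
    by move=> iC jC; apply: (index_inj i); rewrite mem_enum.
  (* Values are below [d] on [B] and at least [d] off [B], so the mixed cases are contradictory. *)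
  move=> i j; rewrite /f; case: ifPn => iB; case: ifPn => jB.
  - move/eqP; rewrite nth_uniq ?size_one_line ?uniq_one_line ?idxB // => /eqP.
    exact: index_eq.
  - by move=> e; have := one_line_lt v (idxB i iB); rewrite e ltnNge leq_addr.
  - by move=> e; have := one_line_lt v (idxB j jB); rewrite -e ltnNge leq_addr.
  - by move/addnI; apply: index_eq; rewrite inE.
have g_inj : injective (fun j => Ordinal (f_lt j)).
  by move=> i j /(congr1 val) /f_inj.
exists (perm g_inj); rewrite !inE cB eqxx /=.
suff -> : subword (perm g_inj) B = one_line v by apply: order_isomorphic_refl.
have sz : size (subword (perm g_inj) B) = d by rewrite size_map -cardE.
apply: (eq_from_nth (x0 := 0%N)); rewrite sz ?size_one_line // => i id.
have iB : (i < size (enum B))%N by rewrite -cardE cB.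
(* [nth_map] needs a default in ['I_n]; [i < d] shows that [B] is inhabited. *)
have [x0 _] : exists x0, x0 \in B
  by apply/card_gt0P; rewrite cB (leq_trans _ id).
rewrite (nth_map x0) // permE /= /f.
by rewrite -mem_enum mem_nth // index_uniq // enum_uniq.
Qed.

Lemma bigcup_occurrences (n d : nat) (v : 'S_d) :
  \bigcup_(p : 'S_n) occurrences v p = dsubsets n d.
Proof.
apply/setP => B; apply/bigcupP/idP => [[p _]|]; first by rewrite inE => /andP[].
by rewrite inE => /eqP /(dsubset_occurrence v) [p pB]; exists p.
Qed.

(** * Regrouping the product by permutations *)

Lemma card_dsubsets (n d : nat) : #|dsubsets n d| = 'C(n, d).
Proof. by rewrite card_draws card_ord. Qed.

(** Permutations are grouped by their occurrence family, and the families by cardinality. *)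
Lemma prod_occurrence_count (R : realType) (n d : nat) (v : 'S_d)
    (g : {set {set 'I_n}} -> R) :
  g set0 = 1 ->
  \prod_(1 <= r < 'C(n, d).+1)
    \prod_(BB : {set {set 'I_n}} | (BB \subset dsubsets n d) && (#|BB| == r))
      g BB ^+ occurrence_count v BB
  = \prod_(p : 'S_n) g (occurrences v p).
Proof.
move=> g0; rewrite [RHS](partition_big (occurrences v)
  (fun BB => BB \subset dsubsets n d)) /=; last first.
  by move=> p _; apply/subsetP => B; rewrite inE => /andP[].
under [RHS]eq_bigr => BB _.
  under eq_bigr => p /eqP -> do over.
  rewrite prodr_const; have -> : #|[pred p | occurrences v p == BB]| =
    occurrence_count v BB by rewrite /occurrence_count cardsE.
  over.
(* A family of [d]-subsets has at most ['C(n, d)] members, so [inord] keeps its cardinality. *)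
pose k (BB : {set {set 'I_n}}) : 'I_('C(n, d).+1) := inord #|BB|.
rewrite [RHS](partition_big k predT) //= big_ord_recl big_add1 /= big_mkord.
have kE (BB : {set {set 'I_n}}) (i : 'I_('C(n, d).+1)) :
    (BB \subset dsubsets n d) && (k BB == i) =
    (BB \subset dsubsets n d) && (#|BB| == i).
  apply: andb_id2l => /subset_leq_card; rewrite card_dsubsets => le.
  by rewrite -val_eqE /= inordK.
(* The block of cardinality 0, missing on the left, holds only the empty family and equals 1 by
   [g0]. *)
rewrite [X in X * _]big1 ?mul1r; last first.
  by move=> BB; rewrite kE cards_eq0 => /andP[_ /eqP ->]; rewrite g0 expr1n.
by apply: eq_bigr => i _; apply: eq_bigl => BB; rewrite kE.
Qed.

Theorem theorem2 (R : realType) (n d : nat) (hd : (1 <= d)%N) (hdn : (d <= n)%N)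
  (v : 'S_d) (mu : {set 'I_n} -> R)
  (hprob : probability_measure mu) (hlsm : log_supermodular mu) :
  \prod_(1 <= r < 'C(n, d).+1)
    \prod_(BB : {set {set 'I_n}} | (BB \subset dsubsets n d) && (#|BB| == r))
      nu mu BB ^+ occurrence_count v BB
  <= \sum_(A : {set 'I_n} | (#|A| < d)%N) mu A.
Proof.
rewrite (prod_occurrence_count _ (nu_set0 hprob)) -nu_dsubsets.
rewrite -(bigcup_occurrences n v); exact: prod_nu_le.
Qed.
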